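(* Let $G$ be a graph. Then there is a homotopy equivalence \[ \Sigma\, \mathcal{N}[\overline{G}] \simeq \mathcal{I}(K_2 \times G).\] In particular, if $G$ is bipartite, then $\Sigma\, \mathcal{N}[\overline{G}] \simeq \mathcal{I}(G) * \mathcal{I}(G)$.
   Context: A graph $G$ is a pair $(V(G),E(G))$ with $V(G)$ a (possibly infinite) set and $E(G)\subset V(G)^2\setminus\{(v,v)\}$ symmetric, i.e. graphs are undirected, simple, not necessarily finite. An (abstract) simplicial complex on a ground set $X$ is a family of finite subsets of $X$ closed under taking subsets; every simplicial complex is assumed to contain the empty set $\emptyset$. Homotopy statements refer to geometric realizations; $\Sigma$ denotes suspension (so the suspension of the complex $\{\emptyset\}$ is $S^0$) and $*$ denotes join. The closed neighborhood of $v$ is $N_G[v]=\{v\}\cup\{w : (v,w)\in E(G)\}$. The closed neighborhood complex $\mathcal{N}[G]$ is the simplicial complex on $V(G)$ whose simplices are the finite subsets $\sigma\subset V(G)$ such that $\sigma\subset N_G[v]$ for some $v\in V(G)$. $\overline{G}$ is the complement graph ($V(\overline G)=V(G)$, distinct $v,w$ adjacent iff not adjacent in $G$). $K_2$ is the complete graph on two vertices, and $K_2\times G$ is the categorical product: vertex set $V(K_2)\times V(G)$, with $(a,v),(b,w)$ adjacent iff $a\neq b$ and $(v,w)\in E(G)$. The independence complex $\mathcal{I}(G)$ is the simplicial complex on $V(G)$ whose simplices are the finite subsets no two of whose elements are adjacent in $G$.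
   Formalization: The graph G is assumed to have at least one vertex; for the graph with no vertices the suspension of N of the complement is S^0, while I(K_2 x G) and I(G) * I(G) have empty realization, so the claim fails there. *)

(* Defs.v *)
From HB Require Import structures.
From mathcomp Require Import all_boot all_order all_algebra finmap.
From mathcomp Require Import all_classical all_reals all_analysis.
Import numFieldNormedType.Exports.

Set Implicit Arguments.
Unset Strict Implicit.
Unset Printing Implicit Defensive.
Import Order.TTheory GRing.Theory Num.Theory.
Local Open Scope classical_set_scope.
Local Open Scope ring_scope.

Record graph (V : choiceType) := Graph {
  adj :> rel V;
  adj_sym : symmetric adj;
  adj_irr : irreflexive adj }.

Section Graphs.
Variable V : choiceType.
Implicit Type G : graph V.

Definition closed_nbhd G (v : V) : pred V := [pred w | (w == v) || G v w].

Definition compl_adj G : rel V := fun v w => (v != w) && ~~ G v w.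

Lemma compl_adj_sym G : symmetric (compl_adj G).
Proof. by move=> v w; rewrite /compl_adj eq_sym adj_sym. Qed.

Lemma compl_adj_irr G : irreflexive (compl_adj G).
Proof. by move=> v; rewrite /compl_adj eqxx. Qed.

Definition compl_graph G := Graph (@compl_adj_sym G) (@compl_adj_irr G).

Definition bipartite G := exists c : V -> bool, forall v w, G v w -> c v != c w.

End Graphs.

Definition K2_adj : rel bool := fun a b => a != b.

Lemma K2_adj_sym : symmetric K2_adj.
Proof. by move=> a b; rewrite /K2_adj eq_sym. Qed.

Lemma K2_adj_irr : irreflexive K2_adj.
Proof. by move=> a; rewrite /K2_adj eqxx. Qed.

Definition K2 : graph bool := Graph K2_adj_sym K2_adj_irr.

Section CategoricalProduct.
Variables (V W : choiceType) (G : graph V) (H : graph W).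

Definition prod_adj : rel (V * W)%type := fun p q => G p.1 q.1 && H p.2 q.2.

Lemma prod_adj_sym : symmetric prod_adj.
Proof. by move=> p q; rewrite /prod_adj (adj_sym G) (adj_sym H). Qed.

Lemma prod_adj_irr : irreflexive prod_adj.
Proof. by move=> p; rewrite /prod_adj adj_irr. Qed.

Definition prod_graph := Graph prod_adj_sym prod_adj_irr.

End CategoricalProduct.

Record simplicial_complex (X : choiceType) := SimplicialComplex {
  simplex : set {fset X};
  simplex0 : simplex fset0;
  simplexS : forall s t : {fset X}, (s `<=` t)%fset -> simplex t -> simplex s }.

Section GraphComplexes.
Variables (V : choiceType) (G : graph V).

(* The disjunct [s = fset0] is redundant as soon as [V] is inhabited; it makes
   the family a simplicial complex also for the graph without vertices. *)
Definition closed_nbhd_simplex : set {fset V} :=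
  [set s | s = fset0 \/ exists v, {subset s <= closed_nbhd G v}].

Lemma closed_nbhd_simplex0 : closed_nbhd_simplex fset0.
Proof. by left. Qed.

Lemma closed_nbhd_simplexS (s t : {fset V}) :
  (s `<=` t)%fset -> closed_nbhd_simplex t -> closed_nbhd_simplex s.
Proof.
move=> /fsubsetP st [t0|[v tv]]; last by right; exists v => x /st /tv.
by left; apply/eqP; rewrite -fsubset0 -t0; apply/fsubsetP.
Qed.

Definition closed_nbhd_complex : simplicial_complex V :=
  SimplicialComplex closed_nbhd_simplex0 closed_nbhd_simplexS.

Definition indep_simplex : set {fset V} :=
  [set s | {in s &, forall v w, ~~ G v w}].

Lemma indep_simplex0 : indep_simplex fset0.
Proof. by move=> v w; rewrite inE. Qed.

Lemma indep_simplexS (s t : {fset V}) :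
  (s `<=` t)%fset -> indep_simplex t -> indep_simplex s.
Proof. by move=> /fsubsetP st it v w /st vt /st wt; exact: it. Qed.

Definition indep_complex : simplicial_complex V :=
  SimplicialComplex indep_simplex0 indep_simplexS.

End GraphComplexes.

Section Join.
Variables (X Y : choiceType) (K : simplicial_complex X)
  (L : simplicial_complex Y).

Definition join_simplex : set {fset (X + Y)%type} :=
  [set u | exists s t, [/\ simplex K s, simplex L t &
     u = ([fset inl x | x in s] `|` [fset inr y | y in t])%fset]].

Lemma join_simplex0 : join_simplex fset0.
Proof.
exists fset0, fset0; split; [exact: simplex0|exact: simplex0|].
by apply/fsetP => z; rewrite !inE; apply/esym/norP; split;
  apply/imfsetP => -[].
Qed.

Lemma join_simplexS (u u' : {fset (X + Y)%type}) :
  (u `<=` u')%fset -> join_simplex u' -> join_simplex u.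
Proof.
move=> /fsubsetP uu' [s [t [Ks Lt u'E]]].
exists [fset x in s | inl x \in u]%fset, [fset y in t | inr y \in u]%fset.
split.
- by apply: simplexS Ks; apply/fsubsetP => x; rewrite !inE => /andP[].
- by apply: simplexS Lt; apply/fsubsetP => y; rewrite !inE => /andP[].
apply/fsetP => z; rewrite inE; apply/idP/orP => [zu|].
  have := uu' _ zu; rewrite u'E inE => /orP[] /imfsetP[x /= xs zE].
    by left; apply/imfsetP; exists x => //=; rewrite !inE xs -zE.
  by right; apply/imfsetP; exists x => //=; rewrite !inE xs -zE.
by case=> /imfsetP[x /=]; rewrite !inE => /andP[_ xu] ->.
Qed.

Definition join_complex : simplicial_complex (X + Y)%type :=
  SimplicialComplex join_simplex0 join_simplexS.

End Join.

(* The 0-sphere: two vertices and no edge. *)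
Definition S0_simplex : set {fset bool} := [set s | (#|` s| <= 1)%N].

Lemma S0_simplex0 : S0_simplex fset0.
Proof. by rewrite /S0_simplex/mkset cardfs0. Qed.

Lemma S0_simplexS (s t : {fset bool}) :
  (s `<=` t)%fset -> S0_simplex t -> S0_simplex s.
Proof. by move=> /fsubset_leq_card; exact: leq_trans. Qed.

Definition S0_complex : simplicial_complex bool :=
  SimplicialComplex S0_simplex0 S0_simplexS.

Definition susp_complex (X : choiceType) (K : simplicial_complex X) :=
  join_complex S0_complex K.

Section Realization.
Variables (R : realType) (X : choiceType) (K : simplicial_complex X).

(* Barycentric coordinates: finitely supported functions [X -> R]. *)
Definition realization_pred (p : {fsfun X -> R with 0}) : bool :=
  [&& `[< simplex K (finsupp p) >], [forall x : finsupp p, 0 <= p (val x)]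
    & \sum_(x <- finsupp p) p x == 1].

Record realization := Realization {
  coords :> {fsfun X -> R with 0};
  coordsP : realization_pred coords }.

HB.instance Definition _ := [isSub for coords].
HB.instance Definition _ := [Choice of realization by <:].

(* The weak (coherent) topology: [U] is open iff its trace on every closed
   simplex is open; a closed simplex has finitely many vertices, so the
   supremum distance on coordinates induces its Euclidean topology. *)
Definition realization_open : set_system realization := [set U |
  forall s : {fset X}, simplex K s ->
  forall p : realization, (finsupp p `<=` s)%fset -> U p ->
  exists2 e : R, 0 < e & forall q : realization, (finsupp q `<=` s)%fset ->
    (forall x, `|p x - q x| < e) -> U q].

Lemma realization_openT : realization_open setT.
Proof. by move=> s _ p _ _; exists 1. Qed.

Lemma realization_openI : setI_closed realization_open.
Proof.
move=> U W oU oW s Ks p ps [Up Wp].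
have [e e0 eU] := oU s Ks p ps Up; have [d d0 dW] := oW s Ks p ps Wp.
exists (Num.min e d) => [|q qs pq]; first by rewrite lt_min e0.
by split; [apply: eU|apply: dW] => // x; have := pq x;
  rewrite lt_min => /andP[].
Qed.

Lemma realization_open_bigU (I : Type) (f : I -> set realization) :
  (forall i, realization_open (f i)) -> realization_open (\bigcup_i f i).
Proof.
move=> of_ s Ks p ps [i _ fip]; have [e e0 eU] := of_ i s Ks p ps fip.
by exists e => // q qs pq; exists i => //; exact: eU.
Qed.

HB.instance Definition _ := isOpenTopological.Build realization
  realization_openT realization_openI realization_open_bigU.

End Realization.

Definition homotopic (R : realType) (A B : topologicalType) (f g : A -> B) :=
  exists H : R * A -> B,
    [/\ {within `[0%R, 1%R] `*` [set: A], continuous H},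
        forall a, H (0, a) = f a & forall a, H (1, a) = g a].

Definition homotopy_equivalent (R : realType) (A B : topologicalType) :=
  exists (f : A -> B) (g : B -> A),
    [/\ continuous f, continuous g,
        homotopic R (g \o f) id & homotopic R (f \o g) id].

(* Main.v *)
Require Import Defs.
From mathcomp Require Import all_boot all_order all_algebra finmap.
From mathcomp Require Import all_classical all_reals all_analysis.
From mathcomp Require Import lra.
Import Order.TTheory GRing.Theory Num.Theory.
Import numFieldNormedType.Exports.

(* A point of [I (K_2 * G)] is a pair of weight functions [(a, b)] on [V], of
   total mass 1, with no edge of [G] between the two supports.  A point of the
   suspension of [N [compl G]] is [(n, s, g)] with [n] and [s] the weights of
   the two poles and [g] supported on a set having a common non-neighbor.  Up to
   normalization, one map sends [(a, b)] to
     [n = (|b| - |a|)^+], [s = (|a| - |b|)^+], [g = |b| a].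
   In the other direction, given [g] with maximum [m], let [g' = (g - m/2)^+]
   and spread a weight function [b g] over chosen common non-neighbors of those
   sets [S] included in the support of [g] outside which [g < m/2]: each such
   [S] contains the support of [g'], so [(g', b g)] is a point of
   [I (K_2 * G)]; near the poles it is deformed into a fixed vertex.
   Both composites are joined to the identity by two successive straight-line
   homotopies, so that everything reduces to comparing supports.  For [G]
   bipartite, [I (K_2 * G)] is isomorphic to [I (G) * I (G)] by exchanging the
   two copies of [V] over one color class. *)

Set Implicit Arguments.
Unset Strict Implicit.
Unset Printing Implicit Defensive.
Local Open Scope ring_scope.
Local Open Scope classical_set_scope.

(** * The weak topology *)

Section Realization.
Variables (R : realType) (X : choiceType) (K : simplicial_complex X).
Implicit Type p q : realization R K.

Lemma realization_ge0 p x : 0 <= p x.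
Proof.
have /and3P[_ /forallP p0 _] := coordsP p.
by case: finsuppP => // xp; exact: (p0 [` xp]%fset).
Qed.

Lemma realization_simplex p : simplex K (finsupp p).
Proof. by have /and3P[/asboolP] := coordsP p. Qed.

Lemma realization_sum p : \sum_(x <- finsupp p) p x = 1.
Proof. by have /and3P[_ _ /eqP] := coordsP p. Qed.

Lemma realization_neq0 p : exists x, p x != 0.
Proof.
apply: contrapT => /forallNP p0; have := realization_sum p.
rewrite big1_seq => [/eqP|x _]; first by rewrite eq_sym oner_eq0.
by apply/eqP; rewrite -[_ == _]negbK; apply/negP/p0.
Qed.

Lemma openE_realization (U : set (realization R K)) :
  open U = realization_open U.
Proof. by []. Qed.

(** Sup-distance balls around [p] traced on the closed simplex [s]. Weak openness is membership in
    all these filters, so limits can be handled one simplex at a time. *)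
Definition simplex_nbhs (s : {fset X}) p : set_system (realization R K) :=
  filter_from [set e : R | 0 < e]
    (fun e => [set q : realization R K |
       (finsupp q `<=` s)%fset /\ forall x, `|p x - q x| < e]).

#[global] Instance simplex_nbhs_filter s p : Filter (simplex_nbhs s p).
Proof.
apply: filter_from_filter; first by exists 1; rewrite /= ltr01.
move=> d e d0 e0; exists (Num.min d e); first by rewrite /= lt_min d0.
by move=> q [qs pq]; split; split => // x; have := pq x;
  rewrite lt_min => /andP[].
Qed.

Lemma simplex_nbhs_cvg s p : simplex K s -> (finsupp p `<=` s)%fset ->
  simplex_nbhs s p --> p.
Proof.
move=> Ks ps U; rewrite /= nbhsE => -[W [oW Wp] WU].
move: oW; rewrite openE_realization => /(_ s Ks p ps Wp)[e e0 eW].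
by exists e => // q [qs pq]; apply: WU; exact: eW.
Qed.

Lemma simplex_nbhs_finsupp s p :
  simplex_nbhs s p [set q : realization R K | (finsupp q `<=` s)%fset].
Proof. by exists 1; [exact: ltr01|move=> q []]. Qed.

Lemma openP_simplex_nbhs (U : set (realization R K)) :
  (forall s p, simplex K s -> (finsupp p `<=` s)%fset -> U p ->
     simplex_nbhs s p U) -> open U.
Proof.
move=> sU; rewrite openE_realization => s Ks p ps Up.
have [e e0 eU] := sU s p Ks ps Up; exists e => // q qs pq.
exact: eU.
Qed.

Lemma continuous_coord x : continuous (fun p => p x : R).
Proof.
apply/continuousP => U oU; apply: openP_simplex_nbhs => s p Ks ps Up.
have /nbhs_ballP[e e0 eU] : nbhs (p x : R) U by exact: open_nbhs_nbhs.
by exists e => // q [qs pq]; apply: eU; exact: pq.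
Qed.

(** Meant for sums and maxima over [finsupp p]: on the closed simplex [s] they agree with the same
    expression over the fixed index set [s], which is continuous everywhere. *)
Lemma continuous_on_simplices (T : topologicalType) (f : realization R K -> T) :
  (forall s, exists2 g : realization R K -> T, continuous g &
     forall p, (finsupp p `<=` s)%fset -> f p = g p) ->
  continuous f.
Proof.
move=> fg; apply/continuousP => U oU; apply: openP_simplex_nbhs => s p Ks ps Up.
have [g cg gE] := fg s.
have : nbhs p (g @^-1` U).
  by apply: cg; apply: open_nbhs_nbhs; split => //; rewrite -gE.
move=> /(simplex_nbhs_cvg Ks ps) gU; have := simplex_nbhs_finsupp s p.
by apply: filterS2 gU => q /=; rewrite /preimage/= => Ugq /gE ->.
Qed.

(* For [z] close to the limit, [finsupp (h z)] is one of the finitely many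
   subsets of [T] containing [finsupp l], each handled by its own radius. *)
Lemma cvg_realization (Z : Type) (F : set_system Z) (FF : Filter F)
    (h : Z -> realization R K) (l : realization R K) (T : {fset X}) :
  (\forall z \near F, (finsupp (h z) `<=` T)%fset) ->
  (forall x, (fun z => h z x : R) @ F --> (l x : R)) ->
  h @ F --> l.
Proof.
move=> hT hl U; rewrite nbhsE => -[W [oW Wl] WU].
suff hW S : S \in fpowerset T ->
    F [set z | finsupp (h z) = S -> W (h z)].
  have := filter_bigI FF hW; apply: filterS2 hT => z hzT.
  by move=> /(_ (finsupp (h z))) /= hzW; apply/WU/hzW => //;
     rewrite fpowersetE.
move=> ST; have [KS|nKS] := pselect (simplex K S); last first.
  apply: filterE => z hzS; exfalso; apply: nKS; rewrite -hzS.
  exact: realization_simplex.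
(* If the limit has a vertex outside [S], its weight stays nonzero nearby, so the support is
   eventually different from [S]. *)
have [lS|] := boolP (finsupp l `<=` S)%fset; last first.
  move=> /fsubsetPn[x]; rewrite mem_finsupp => lx xS.
  have : F [set z | (h z x : R) != 0].
    apply: (hl x [set r : R | r != 0]).
    by apply: open_nbhs_nbhs; split => //; exact: open_neq.
  by apply: filterS => z /= hzx hzS; move: xS; rewrite -hzS mem_finsupp hzx.
move: oW; rewrite openE_realization => /(_ S KS l lS Wl)[e e0 eW].
have : F (\bigcap_(x in [set` S]) [set z | `|l x - h z x| < e]).
  apply: filter_bigI => x xS.
  have : F [set z | ball (l x : R) e (h z x)].
    by apply: (hl x (ball (l x : R) e)); exact: nbhsx_ballx.
  by apply: filterS.
apply: filterS => z /= lhz hzS; apply: eW; first by rewrite hzS.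
move=> x; have [xS|xS] := boolP (x \in S); first exact: lhz.
rewrite (fsfun_dflt (_ : x \notin finsupp (h z))) ?hzS//.
by rewrite fsfun_dflt ?subrr ?normr0//; apply: contra xS; exact: (fsubsetP lS).
Qed.

End Realization.

(* The tube lemma on each closed simplex replaces the fact that products with
   the interval preserve the weak topology. *)
Lemma continuous_realization_homotopy (R : realType) (X Y : choiceType)
    (K : simplicial_complex X) (L : simplicial_complex Y)
    (H : R * realization R K -> realization R L) :
  (forall y, continuous (fun z => H z y : R)) ->
  (forall s : {fset X}, exists T : {fset Y}, forall t (p : realization R K),
     (finsupp p `<=` s)%fset -> (finsupp (H (t, p)) `<=` T)%fset) ->
  continuous H.
Proof.
move=> cH fH [t0 p0] U; rewrite nbhsE => -[B [oB Bp] BU].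
have lineH p : continuous (fun t => H (t, p)).
  move=> t; have [T HT] := fH (finsupp p).
  apply: (@cvg_realization _ _ _ _ _ _ _ _ T) => [|y].
    by apply: filterE => t'; exact: HT.
  apply: (@cvg_comp _ _ _ (fun t' => (t', p)) (fun z => H z y : R)
    _ (nbhs (t, p))); last exact: cH.
  by apply: (@cvg_pair _ _ _ _ (nbhs t) (nbhs p));
    [exact: cvg_id|exact: cvg_cst].
have : nbhs t0 [set t | B (H (t, p0))].
  by apply: (lineH p0 t0); apply: open_nbhs_nbhs.
move=> /nbhs_ballP[e /= e0 eB].
(* Halving the radius gives a compact interval still mapped into [B] at [p0]; [W] collects the
   points for which all of [J] is mapped into [B]. *)
pose J : set R := `[t0 - e / 2, t0 + e / 2].
pose W := [set p | forall t, J t -> B (H (t, p))].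
have Wp0 : W p0.
  move=> t; rewrite /J/= in_itv/= => /andP[t1 t2]; apply: eB.
  by rewrite /ball/= ltr_norml; apply/andP; split; lra.
have oW : open W.
  apply: openP_simplex_nbhs => s p Ks ps Wp.
  have [T HT] := fH s.
  have /compact_near_coveringP cJ : compact J by exact: segment_compact.
  have /cJ : forall t, J t -> \forall t' \near t & q \near simplex_nbhs s p,
      B (H (t', q)).
    move=> t Jt.
    have HB : nbhs (H (t, p)) B.
      by apply: open_nbhs_nbhs; split => //; exact: Wp.
    suff : H @ filter_prod (nbhs t) (simplex_nbhs s p) --> H (t, p).
      case/(_ B HB) => -[A1 A2] A12 AB; exists (A1, A2) => //.
      by move=> [a b]; exact: AB.
    apply: (@cvg_realization _ _ _ _
      (filter_prod (nbhs t) (simplex_nbhs s p)) _ _ _ T) => [|y].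
      exists (setT, [set q : realization R K | (finsupp q `<=` s)%fset]) => /=.
        by split; [exact: filterT|exact: simplex_nbhs_finsupp].
      by move=> [t' q] /= [_ qs]; exact: HT.
    apply: (@cvg_trans _ ((fun z => H z y : R) @ nbhs (t, p))); last exact: cH.
    apply: cvg_app => A [[A1 A2] [/= tA1 pA2] AA].
    exists (A1, A2) => //; split => //=.
    exact: (simplex_nbhs_cvg Ks ps).
  by apply: filterS => q /= JB t Jt; exact: JB.
exists (J, W) => /=.
  split; last exact: open_nbhs_nbhs.
  apply/nbhs_ballP; exists (e / 2) => /=; first by rewrite divr_gt0.
  move=> t; rewrite /ball/= ltr_norml /J/= in_itv/= => /andP[].
  by move=> h1 h2; apply/andP; split; lra.
by move=> [t p] /= [Jt Wp]; apply: BU; exact: Wp.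
Qed.

(** * Maps determined by weights *)

Section ContinuousReal.
Variables (R : realType) (T : topologicalType).
Implicit Types f g : T -> R.

Lemma continuous_add f g :
  continuous f -> continuous g -> continuous (fun x => f x + g x).
Proof. by move=> cf cg x; exact: cvgD (cf x) (cg x). Qed.

Lemma continuous_sub f g :
  continuous f -> continuous g -> continuous (fun x => f x - g x).
Proof. by move=> cf cg x; exact: cvgB (cf x) (cg x). Qed.

Lemma continuous_mul f g :
  continuous f -> continuous g -> continuous (fun x => f x * g x).
Proof. by move=> cf cg x; exact: cvgM (cf x) (cg x). Qed.

Lemma continuous_div f g : (forall x, g x != 0) ->
  continuous f -> continuous g -> continuous (fun x => f x / g x).
Proof. by move=> g0 cf cg x; exact: cvgM (cf x) (cvgV (g0 x) (cg x)). Qed.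

Lemma continuous_maxr f g :
  continuous f -> continuous g -> continuous (fun x => Num.max (f x) (g x)).
Proof. by move=> cf cg x; exact: continuous_max (cf x) (cg x). Qed.

Lemma continuous_minr f g :
  continuous f -> continuous g -> continuous (fun x => Num.min (f x) (g x)).
Proof. by move=> cf cg x; exact: continuous_min (cf x) (cg x). Qed.

Lemma continuous_cst (a : R) : continuous (fun _ : T => a).
Proof. by move=> x; exact: cvg_cst. Qed.

End ContinuousReal.

Lemma sum_fset_supp (R : realType) (X : choiceType) (A B : {fset X})
    (w : X -> R) :
  (A `<=` B)%fset -> (forall x, w x != 0 -> x \in A) ->
  \sum_(x <- A) w x = \sum_(x <- B) w x.
Proof.
by move=> AB wA; apply: big_fset_incl => // x _; apply: contraNeq; exact: wA.
Qed.

(** Normalization by the total weight. The support enters only through a finite bound [T] and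
    through its finite subsets, so it never has to be computed. *)
Lemma realization_of_weights (R : realType) (X : choiceType)
    (K : simplicial_complex X) (w : X -> R) (T : {fset X}) :
  (forall x, 0 <= w x) -> (forall x, w x != 0 -> x \in T) ->
  (exists x, w x != 0) ->
  (forall S : {fset X}, (forall x, x \in S -> w x != 0) -> simplex K S) ->
  exists p : realization R K, forall x, p x = w x / \sum_(z <- T) w z.
Proof.
move=> w0 wT [x0 wx0] wK; set tot := \sum_(z <- T) w z.
have tot0 : tot != 0.
  rewrite psumr_neq0//.
  by apply/hasP; exists x0; rewrite ?wT //= lt_def wx0 w0.
pose q : {fsfun X -> R with 0} := [fsfun x in T => w x / tot | 0].
have qE x : q x = w x / tot.
  rewrite fsfunE; case: ifPn => // xT.
  have [->|/wT] := eqVneq (w x) 0; first by rewrite mul0r.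
  by rewrite (negPf xT).
suff qP : realization_pred K q by exists (Realization qP).
apply/and3P; split.
- apply/asboolP/wK => x; rewrite mem_finsupp qE; apply: contraNneq => ->.
  by rewrite mul0r.
- apply/forallP => x; rewrite qE divr_ge0// /tot sumr_ge0//.
- rewrite (@sum_fset_supp _ _ _ T); last 2 first.
    by apply/fsubsetP => x; rewrite mem_finsupp qE => h; apply: wT;
      apply: contraNneq h => ->; rewrite mul0r.
    by move=> x; rewrite mem_finsupp.
  by under eq_bigr do rewrite qE; rewrite -mulr_suml divff.
Qed.

(** * Tame maps and straight-line homotopies *)

Section TameMaps.
Variable R : realType.

(** Continuity of coordinates alone is too weak for the weak topology; the second clause, which
    confines the image of each closed simplex to finitely many vertices, makes up for it. *)
Definition tame (X Y : choiceType) (K : simplicial_complex X)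
    (L : simplicial_complex Y) (F : realization R K -> realization R L) :=
  (forall y, continuous (fun p => F p y : R)) /\
  (forall s : {fset X}, exists T : {fset Y}, forall p : realization R K,
     (finsupp p `<=` s)%fset -> (finsupp (F p) `<=` T)%fset).

Lemma tame_id (X : choiceType) (K : simplicial_complex X) :
  tame (@id (realization R K)).
Proof. by split => [y|s]; [exact: continuous_coord|exists s]. Qed.

(** A tame map is a homotopy that does not depend on time, restricted to time 0. *)
Lemma tame_continuous (X Y : choiceType) (K : simplicial_complex X)
    (L : simplicial_complex Y) (F : realization R K -> realization R L) :
  tame F -> continuous F.
Proof.
move=> [cF fF] p.
have cH : continuous (fun z : R * realization R K => F z.2).
  apply: continuous_realization_homotopy => [y z|s].
    apply: (@continuous_comp _ _ _ snd (fun q => F q y : R)).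
      exact: cvg_snd.
    exact: cF.
  by have [T FT] := fF s; exists T => t q; exact: FT.
have c0 : continuous (fun q : realization R K => (0 : R, q)).
  move=> q; have := @cvg_pair _ _ _ (nbhs q) (nbhs (0 : R)) (nbhs q) _ _ _
    (fun=> 0) id; apply; [exact: cvg_cst|exact: cvg_id].
exact: (continuous_comp (c0 p) (cH _)).
Qed.

Lemma tame_comp (X Y Z : choiceType) (K : simplicial_complex X)
    (L : simplicial_complex Y) (M : simplicial_complex Z)
    (F : realization R K -> realization R L)
    (G : realization R L -> realization R M) :
  tame F -> tame G -> tame (G \o F).
Proof.
move=> tF [cG fG]; split => [z p|s].
  apply: (@continuous_comp _ _ _ F (fun q => G q z : R)).
    exact: tame_continuous.
  exact: cG.
have [T FT] := tF.2 s; have [U GU] := fG T; exists U => p ps.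
by apply: GU; exact: FT.
Qed.

(** Source of all maps below. The conclusion retains only the supports, since membership in a
    complex and the straight-line criterion depend on nothing else. *)
Lemma tame_of_weights (X Y : choiceType) (K : simplicial_complex X)
    (L : simplicial_complex Y) (w : realization R K -> Y -> R) :
  (forall p y, 0 <= w p y) -> (forall p, exists y, w p y != 0) ->
  (forall p (S : {fset Y}), (forall y, y \in S -> w p y != 0) ->
     simplex L S) ->
  (forall y, continuous (w ^~ y)) ->
  (forall s : {fset X}, exists T : {fset Y}, forall p : realization R K,
     (finsupp p `<=` s)%fset -> forall y, w p y != 0 -> y \in T) ->
  exists2 F : realization R K -> realization R L, tame F &
    forall p y, (F p y != 0) = (w p y != 0).
Proof.
move=> w0 wN0 wL cw /choice[T wT].
(* The total does not depend on the finite set bounding the support: both sums equal the one over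
   the union. Hence on the closed simplex [s] it is a sum over the fixed set [T s]. *)
have sumE s (p : realization R K) : (finsupp p `<=` s)%fset ->
    \sum_(y <- T (finsupp p)) w p y = \sum_(y <- T s) w p y.
  move=> ps.
  rewrite (sum_fset_supp (fsubsetUl _ (T s)) (wT _ p (fsubset_refl _))).
  by rewrite -(sum_fset_supp (fsubsetUr _ (T s)) (wT _ p ps)).
have := fun p : realization R K =>
  realization_of_weights (w0 p) (wT _ p (fsubset_refl _)) (wN0 p) (wL p).
move=> /choice[F FE].
pose tot (p : realization R K) := \sum_(y <- T (finsupp p)) w p y.
have tot0 p : tot p != 0.
  have [y wy] := wN0 p; rewrite psumr_neq0//.
  by apply/hasP; exists y; rewrite ?(wT _ _ (fsubset_refl _)) //= lt_def wy w0.
have ctot : continuous tot.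
  apply: continuous_on_simplices => s.
  exists (fun p => \sum_(y <- T s) w p y); last exact: sumE.
  by apply: continuous_big => //; exact: add_continuous.
exists F => [|p y]; last by rewrite FE mulf_eq0 invr_eq0 negb_or tot0 andbT.
split=> [y|s].
  rewrite (_ : (fun p => _) = fun p => w p y / tot p); last first.
    by apply/funext => p; rewrite FE.
  exact: continuous_div.
exists (T s) => p ps; apply/fsubsetP => y; rewrite mem_finsupp FE mulf_eq0.
by rewrite negb_or => /andP[wpy _]; exact: (wT s p).
Qed.

(** Clamped coefficients, defined for all real times: [start] falls from 1 to 0 on the first half of
    the unit interval, [finish] rises from 0 to 1 on the second half. *)
Let start (t : R) := Num.min 1 (Num.max 0 (1 - 2 * t)).
Let finish (t : R) := Num.min 1 (Num.max 0 (2 * t - 1)).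

(** At each time [start] or [finish] vanishes, so the point is a convex combination of [f p] and
    [g p] or of [g p] and [h p], and its support lies in the corresponding union. *)
Lemma homotopic_through (X Y : choiceType) (K : simplicial_complex X)
    (L : simplicial_complex Y) (f g h : realization R K -> realization R L) :
  tame f -> tame g -> tame h ->
  (forall p (S : {fset Y}),
     (forall y, y \in S -> f p y != 0 \/ g p y != 0) -> simplex L S) ->
  (forall p (S : {fset Y}),
     (forall y, y \in S -> g p y != 0 \/ h p y != 0) -> simplex L S) ->
  homotopic R f h.
Proof.
move=> [cf ff] [cg fg] [ch fh] fgL ghL.
have a0 t : 0 <= start t by rewrite /start le_min ler01 le_max lexx.
have c0 t : 0 <= finish t by rewrite /finish le_min ler01 le_max lexx.
have ac t : start t = 0 \/ finish t = 0.
  have [t2|t2] := leP (2 * t) 1.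
    by right; rewrite /finish max_l ?min_r ?ler01// subr_le0.
  by left; rewrite /start max_l ?min_r ?ler01// subr_le0 ltW.
pose mid t := 1 - start t - finish t.
have b0 t : 0 <= mid t.
  rewrite /mid; have [->|->] := ac t.
    by rewrite subr0 subr_ge0 /finish ge_min lexx.
  by rewrite subr0 subr_ge0 /start ge_min lexx.
have cid : continuous (fun t : R => 2 * t).
  by apply: continuous_mul; [exact: continuous_cst|move=> t; exact: cvg_id].
have cstart : continuous start.
  apply: continuous_minr; first exact: continuous_cst.
  apply: continuous_maxr; first exact: continuous_cst.
  by apply: continuous_sub => //; exact: continuous_cst.
have cfinish : continuous finish.
  apply: continuous_minr; first exact: continuous_cst.
  apply: continuous_maxr; first exact: continuous_cst.
  by apply: continuous_sub => //; exact: continuous_cst.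
pose w (z : R * realization R K) y :=
  start z.1 * f z.2 y + mid z.1 * g z.2 y + finish z.1 * h z.2 y.
have wN0 t p y : w (t, p) y != 0 -> [\/ f p y != 0, g p y != 0 | h p y != 0].
  rewrite /w /=; have [->|f0] := eqVneq (f p y) 0; last by constructor 1.
  have [->|g0] := eqVneq (g p y) 0; last by constructor 2.
  have [->|h0] := eqVneq (h p y) 0; last by constructor 3.
  by rewrite !mulr0 !addr0 eqxx.
have HF (z : R * realization R K) : exists p : realization R L,
    forall y, p y = w z y.
  case: z => t p.
  pose T := (finsupp (f p) `|` finsupp (g p) `|` finsupp (h p))%fset.
  have sumT (q : realization R L) : (finsupp q `<=` T)%fset ->
      \sum_(y <- T) q y = 1 :> R.
    move=> qT; rewrite -(realization_sum q); apply/esym/sum_fset_supp => // y.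
    by rewrite mem_finsupp.
  (* The weights are already normalized, so they are the coordinates themselves and the homotopy
     ends exactly at [f] and [h]. *)
  have totE : \sum_(y <- T) w (t, p) y = 1.
    rewrite !big_split/= -!mulr_sumr !sumT.
    - by rewrite !mulr1 /mid; lra.
    - by rewrite /T fsubsetUr.
    - by rewrite /T -fsetUA fsubsetU// fsubsetUl orbT.
    - by rewrite /T -fsetUA fsubsetUl.
  have [||||q qE] := @realization_of_weights R Y L (w (t, p)) T.
  - by move=> y; rewrite /w !addr_ge0 ?mulr_ge0 ?realization_ge0.
  - by move=> y /wN0 []; rewrite !inE !mem_finsupp => -> //; rewrite ?orbT.
  - apply: contrapT => /forallNP w0; move: totE.
    rewrite big1 => [/eqP|y _]; first by rewrite eq_sym oner_eq0.
    by apply/eqP; rewrite -[_ == _]negbK; apply/negP/w0.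
  - move=> S Sw; have [t0|t0] := ac t.
      apply: (ghL p) => y /Sw; rewrite /w /= t0 mul0r add0r.
      have [->|g0] := eqVneq (g p y) 0; last by left.
      have [->|h0] := eqVneq (h p y) 0; last by right.
      by rewrite !mulr0 addr0 eqxx.
    apply: (fgL p) => y /Sw; rewrite /w /= t0 mul0r addr0.
    have [->|g0] := eqVneq (f p y) 0; last by left.
    have [->|h0] := eqVneq (g p y) 0; last by right.
    by rewrite !mulr0 addr0 eqxx.
  - by exists q => y; rewrite qE totE divr1.
have [H HE] := choice HF.
have ext (p q : realization R L) : (forall y, p y = q y) -> p = q.
  by move=> pq; apply/val_inj/fsfunP.
exists H; split.
- apply: continuous_subspaceT.
  apply: continuous_realization_homotopy => [y|s].
    rewrite (_ : (fun z => _) = w^~ y); last by apply/funext => z; rewrite HE.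
    have c1 (u : R -> R) : continuous u ->
        continuous (fun z : R * realization R K => u z.1).
      move=> cu z; apply: (@continuous_comp _ _ _ fst u); last exact: cu.
      exact: cvg_fst.
    have c2 (u : realization R K -> R) : continuous u ->
        continuous (fun z : R * realization R K => u z.2).
      move=> cu z; apply: (@continuous_comp _ _ _ snd u); last exact: cu.
      exact: cvg_snd.
    apply: continuous_add; first apply: continuous_add.
    + apply: continuous_mul; first exact: c1.
      exact: (c2 (fun p => f p y : R)).
    + apply: continuous_mul; last exact: (c2 (fun p => g p y : R)).
      apply: c1; apply: continuous_sub => //; apply: continuous_sub => //.
      exact: continuous_cst.
    + apply: continuous_mul; first exact: c1.
      exact: (c2 (fun p => h p y : R)).
  have [Tf Hf] := ff s; have [Tg Hg] := fg s; have [Th Hh] := fh s.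
  exists (Tf `|` Tg `|` Th)%fset => t p ps; apply/fsubsetP => y.
  rewrite mem_finsupp HE => /wN0; rewrite !inE -!mem_finsupp => -[].
  + by move=> /(fsubsetP (Hf p ps)) ->.
  + by move=> /(fsubsetP (Hg p ps)) ->; rewrite orbT.
  + by move=> /(fsubsetP (Hh p ps)) ->; rewrite orbT.
- move=> p; apply: ext => y; rewrite HE /w /mid /=.
  have -> : start 0 = 1 by rewrite /start mulr0 subr0 max_r ?ler01// minxx.
  have -> : finish 0 = 0.
    by rewrite /finish mulr0 sub0r max_l ?min_r ?ler01 ?oppr_le0.
  by rewrite subr0 subrr !mul0r !addr0 mul1r.
- move=> p; apply: ext => y; rewrite HE /w /mid /=.
  have -> : start 1 = 0.
    by rewrite /start mulr1 max_l ?min_r ?ler01// subr_le0 ler1n.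
  have -> : finish 1 = 1.
    rewrite /finish mulr1 (_ : 2 - 1 = 1); last by lra.
    by rewrite max_r ?ler01// minxx.
  by rewrite subr0 subrr !mul0r !add0r mul1r.
Qed.

End TameMaps.

(** * Masses and flags *)

Lemma max0_neq0 (R : realType) (a : R) : (Num.max 0 a != 0) = (0 < a).
Proof. by case: ltP => [/gt_eqF ->//|]; rewrite eqxx. Qed.

Section MassPeak.
Variables (R : realType) (X : choiceType) (K : simplicial_complex X).
Implicit Types (p : realization R K) (P : pred X).

Lemma realization_gt0 p x : (0 < p x) = (p x != 0).
Proof. by rewrite lt_def realization_ge0 andbT. Qed.

Lemma realization_vertex p x : (forall y, y != x -> p y = 0) -> p x = 1.
Proof.
move=> px; have [x0|x0] := eqVneq (p x) 0.
  have [y] := realization_neq0 p.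
  by have [->|/px ->] := eqVneq y x; rewrite ?x0 eqxx.
rewrite -(realization_sum p) -(@sum_fset_supp _ _ [fset x]%fset (finsupp p)).
- by rewrite big_seq_fset1.
- by rewrite fsub1set mem_finsupp.
- by move=> y; rewrite inE; apply: contraNT => /px ->.
Qed.

Definition mass P p : R := \sum_(x <- finsupp p | P x) p x.

Definition peak P p : R := \big[Num.max/0]_(x <- finsupp p | P x) p x.

Lemma mass_ge0 P p : 0 <= mass P p.
Proof. by apply: sumr_ge0 => x _; exact: realization_ge0. Qed.

Lemma mass_gt0 P p x : P x -> p x != 0 -> 0 < mass P p.
Proof.
move=> Px px; rewrite lt_def mass_ge0 andbT psumr_neq0; last first.
  by move=> y _; exact: realization_ge0.
by apply/hasP; exists x; rewrite ?mem_finsupp// Px realization_gt0.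
Qed.

Lemma mass_gt0P P p : 0 < mass P p -> exists2 x, P x & p x != 0.
Proof.
move=> /gt_eqF/negbT; rewrite psumr_neq0; last first.
  by move=> y _; exact: realization_ge0.
by move=> /hasP[x _ /andP[Px]]; rewrite realization_gt0; exists x.
Qed.

Lemma continuous_mass P : continuous (mass P).
Proof.
apply: continuous_on_simplices => s.
exists (fun p => \sum_(x <- s | P x) p x).
  apply: continuous_big => [|x _]; first exact: add_continuous.
  exact: continuous_coord.
move=> p ps; rewrite /mass big_mkcond [RHS]big_mkcond.
apply: sum_fset_supp => // x.
by case: ifP => _; rewrite ?eqxx// mem_finsupp.
Qed.

Lemma peak_ge0 P p : 0 <= peak P p.
Proof. exact: bigmax_ge_id. Qed.

Lemma le_peak P p x : P x -> p x <= peak P p.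
Proof.
move=> Px; have [xp|xp] := boolP (x \in finsupp p).
  by apply: (@le_bigmax_seq _ _ _ _ _ _ _ (fun x => p x)).
by rewrite fsfun_dflt// peak_ge0.
Qed.

Lemma peak_attained P p : 0 < peak P p -> exists2 x, P x & p x = peak P p.
Proof.
have : peak P p = 0 \/ exists2 x, P x & p x = peak P p.
  rewrite /peak; apply: (big_ind (fun m => m = 0 \/ exists2 x, P x & p x = m)).
  - by left.
  - by move=> a b Ha Hb; case: ltP.
  - by move=> x Px; right; exists x.
by case=> // ->; rewrite ltxx.
Qed.

Lemma peak_gt0 P p x : P x -> p x != 0 -> 0 < peak P p.
Proof.
by move=> Px; rewrite -realization_gt0 => /lt_le_trans; apply; exact: le_peak.
Qed.

Lemma continuous_peak P : continuous (peak P).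
Proof.
apply: continuous_on_simplices => s.
exists (fun p => \big[Num.max/0]_(x <- s | P x) p x).
  apply: continuous_big => [|x _]; last exact: continuous_coord.
  by apply: continuous_maxr => z; [exact: cvg_fst|exact: cvg_snd].
move=> p ps; apply/le_anti/andP; split.
  rewrite /peak big_seq_cond; apply: bigmax_le.
    exact: bigmax_ge_id.
  by move=> x /andP[/(fsubsetP ps) xs Px];
    apply: (@le_bigmax_seq _ _ _ _ _ _ _ (fun x => p x)).
apply: bigmax_le => [|x Px]; first exact: peak_ge0.
exact: le_peak.
Qed.

(** * Cutting at half the peak *)

Definition top_part P p x := Num.max 0 (p x - peak P p / 2).

(** When the peak is positive, this is nonzero exactly if the weights on [P] outside [s] are below
    half the peak (first factor) and [s] lies in the support of [p] (second factor). *)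
Definition flag_weight P (s : {fset X}) p :=
  Num.max 0 (peak P p / 2 - peak (fun x => P x && (x \notin s)) p) *
  \prod_(x <- s) p x.

Lemma top_part_neq0 P p x : top_part P p x != 0 -> p x != 0.
Proof.
rewrite max0_neq0 -realization_gt0 subr_gt0; apply: le_lt_trans.
by rewrite divr_ge0// peak_ge0.
Qed.

Lemma top_part_exists P p x : P x -> p x != 0 ->
  exists2 y, P y & top_part P p y != 0.
Proof.
move=> Px /(peak_gt0 Px) p0; have [y Py yE] := peak_attained p0.
by exists y => //; rewrite max0_neq0 yE; lra.
Qed.

Lemma continuous_top_part P x : continuous (fun p => top_part P p x).
Proof.
apply: continuous_maxr; first exact: continuous_cst.
apply: continuous_sub; first exact: continuous_coord.
by apply: continuous_mul; [exact: continuous_peak|exact: continuous_cst].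
Qed.

Lemma flag_weight_ge0 P s p : 0 <= flag_weight P s p.
Proof.
rewrite mulr_ge0 ?le_max ?lexx// prodr_ge0// => x _; exact: realization_ge0.
Qed.

Lemma flag_weight_sub P s p : flag_weight P s p != 0 ->
  (s `<=` finsupp p)%fset.
Proof.
rewrite mulf_eq0 negb_or => /andP[_]; rewrite prodf_seq_neq0 => /allP ps.
by apply/fsubsetP => x /ps; rewrite mem_finsupp.
Qed.

(** A vertex of [P] above half the peak and outside [s] would raise the peak off [s] above that
    threshold and kill the first factor. *)
Lemma flag_weight_top P s p x : flag_weight P s p != 0 -> P x ->
  top_part P p x != 0 -> x \in s.
Proof.
rewrite mulf_eq0 negb_or => /andP[+ _] Px.
rewrite !max0_neq0 => sp xp; apply: contraT => xs.
have : p x <= peak (fun x => P x && (x \notin s)) p.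
  by apply: le_peak; rewrite Px.
by move: sp xp; lra.
Qed.

(** The whole support is always an admissible flag set: the peak off it is 0. This keeps the flag
    sums from all vanishing. *)
Lemma flag_weight_finsupp P p x : P x -> p x != 0 ->
  flag_weight P (finsupp p) p != 0.
Proof.
move=> Px px; rewrite mulf_neq0//; last first.
  by rewrite prodf_seq_neq0; apply/allP => y; rewrite mem_finsupp.
rewrite max0_neq0 (_ : peak (fun x => P x && (x \notin finsupp p)) p = 0).
  by rewrite subr0 divr_gt0// (peak_gt0 Px px).
apply/le_anti; rewrite peak_ge0 andbT; apply: bigmax_le => // y /andP[_ yp].
by rewrite fsfun_dflt.
Qed.

Lemma continuous_flag_weight P s : continuous (flag_weight P s).
Proof.
apply: continuous_mul; last first.
  apply: continuous_big => [|x _]; last exact: continuous_coord.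
  exact: mul_continuous.
apply: continuous_maxr; first exact: continuous_cst.
apply: continuous_sub; last exact: continuous_peak.
by apply: continuous_mul; [exact: continuous_peak|exact: continuous_cst].
Qed.

Section FlagSum.
Variables (Z : eqType) (c : {fset X} -> Z).

(** Pushforward of the flag weights along [c], which will choose a common non-neighbor of each set:
    the function [b g] of the overview. *)
Definition flag_sum P p z :=
  \sum_(s <- fpowerset (finsupp p) | c s == z) flag_weight P s p.

Lemma flag_sum_ge0 P p z : 0 <= flag_sum P p z.
Proof. by apply: sumr_ge0 => s _; exact: flag_weight_ge0. Qed.

Lemma flag_sum_neq0 P p z : flag_sum P p z != 0 ->
  exists s : {fset X}, [/\ (s `<=` finsupp p)%fset, c s = z &
    flag_weight P s p != 0].
Proof.
rewrite psumr_neq0; last by move=> s _; exact: flag_weight_ge0.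
move=> /hasP[s sp /andP[/eqP cs s0]]; exists s; split => //.
  by rewrite -fpowersetE.
by rewrite gt_eqF.
Qed.

Lemma flag_sum_exists P p x : P x -> p x != 0 -> exists z, flag_sum P p z != 0.
Proof.
move=> Px px; exists (c (finsupp p)).
rewrite psumr_neq0; last by move=> s _; exact: flag_weight_ge0.
apply/hasP; exists (finsupp p); first by rewrite fpowersetE.
by rewrite eqxx lt_def flag_weight_ge0 (flag_weight_finsupp Px px).
Qed.

Lemma continuous_flag_sum P z : continuous (fun p => flag_sum P p z).
Proof.
apply: continuous_on_simplices => s.
exists (fun p => \sum_(t <- fpowerset s | c t == z) flag_weight P t p).
  apply: continuous_big => [|t _]; first exact: add_continuous.
  exact: continuous_flag_weight.
move=> p ps; rewrite /flag_sum big_mkcond [RHS]big_mkcond.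
apply: sum_fset_supp => [|t]; first by rewrite fpowersetS.
by case: ifP => _; rewrite ?eqxx// => /flag_weight_sub; rewrite fpowersetE.
Qed.

End FlagSum.
End MassPeak.

(** * The suspension *)

Lemma join_simplexP (X Y : choiceType) (K : simplicial_complex X)
    (L : simplicial_complex Y) (u : {fset X + Y})
    (s : {fset X}) (t : {fset Y}) :
  (forall x, (x \in s) = (inl x \in u)) ->
  (forall y, (y \in t) = (inr y \in u)) ->
  simplex (join_complex K L) u <-> simplex K s /\ simplex L t.
Proof.
move=> su tu; split=> [[s' [t' [Ks' Lt' uE]]]|[Ks Lt]]; last first.
  exists s, t; split => //; apply/fsetP => -[x|y]; rewrite inE.
    rewrite -su; apply/idP/orP => [xs|]; first by left; apply/imfsetP; exists x.
    by case=> /imfsetP[z /= zs] => // -[->].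
  rewrite -tu; apply/idP/orP => [yt|]; first by right; apply/imfsetP; exists y.
  by case=> /imfsetP[z /= zt] => // -[->].
split.
  rewrite (_ : s = s')//; apply/fsetP => x; rewrite su uE inE.
  apply/orP/idP => [|xs]; last by left; apply/imfsetP; exists x.
  by case=> /imfsetP[z /= zs] => // -[->].
rewrite (_ : t = t')//; apply/fsetP => y; rewrite tu uE inE.
apply/orP/idP => [|yt]; last by right; apply/imfsetP; exists y.
by case=> /imfsetP[z /= zt] => // -[->].
Qed.

Lemma fset_inl_preimage (X Y : choiceType) (u : {fset X + Y}) :
  exists s : {fset X}, forall x, (x \in s) = (inl x \in u).
Proof.
exists [fset x in pmap (fun z => if z is inl x then Some x else None) u]%fset.
move=> x; rewrite inE mem_pmap; apply/mapP/idP => [[[z|z] zu] //= [->] //|xu].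
by exists (inl x).
Qed.

Lemma fset_inr_preimage (X Y : choiceType) (u : {fset X + Y}) :
  exists t : {fset Y}, forall y, (y \in t) = (inr y \in u).
Proof.
exists [fset x in pmap (fun z => if z is inr x then Some x else None) u]%fset.
move=> x; rewrite inE mem_pmap; apply/mapP/idP => [[[z|z] zu] //= [->] //|xu].
by exists (inr x).
Qed.

(** On the diagonal both sides hold: [v] is in its own closed neighborhood, and [G] is
    irreflexive. *)
Lemma closed_nbhd_compl (V : choiceType) (G : graph V) v w :
  (w \in closed_nbhd (compl_graph G) v) = ~~ G v w.
Proof.
rewrite inE /= /compl_adj eq_sym; case: eqVneq => //= ->.
by rewrite adj_irr.
Qed.

(** Equatorial simplices are the finite sets with a common non-neighbor in [G]; for the empty one
    [v0] is the witness. *)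
Lemma susp_closed_nbhd_complP (V : choiceType) (G : graph V) (v0 : V)
    (u : {fset bool + V}) :
  simplex (susp_complex (closed_nbhd_complex (compl_graph G))) u <->
  ~~ ((inl true \in u) && (inl false \in u)) /\
  exists v, forall w, inr w \in u -> ~~ G v w.
Proof.
have [s su] := fset_inl_preimage u; have [t tu] := fset_inr_preimage u.
rewrite (join_simplexP _ _ su tu) /= /S0_simplex /closed_nbhd_simplex /mkset.
rewrite -!su; split => -[s1 t1]; split.
- apply: contraTN s1 => /andP[st sf]; rewrite -ltnNge.
  rewrite (_ : 2%N = #|` [fset true; false]|)%fset; last by rewrite cardfs2.
  by apply: fsubset_leq_card; apply/fsubsetP => -[]; rewrite ?st ?sf.
- case: t1 => [t0|[v tv]]; first by exists v0 => w; rewrite -tu t0.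
  by exists v => w; rewrite -tu => /tv; rewrite closed_nbhd_compl.
- suff [b sb] : exists b, (s `<=` [fset b])%fset.
    by rewrite (leq_trans (fsubset_leq_card sb))// cardfs1.
  have [st|st] := boolP (true \in s).
    exists true; apply/fsubsetP => -[|sf]; rewrite inE//.
    by move: s1; rewrite st sf.
  by exists false; apply/fsubsetP => -[sT|]; rewrite inE// sT in st *.
- case: t1 => v tv; right; exists v => w; rewrite closed_nbhd_compl tu.
  exact: tv.
Qed.

(** * The equivalence, with the target given up to relabelling *)

Section SuspensionEquivalence.
Variables (R : realType) (V : choiceType) (G : graph V) (v0 : V).
(** Up to the relabelling [e], [L] is the independence complex of the product with [K2]. Leaving it
    abstract lets one proof serve both claims. *)
Variables (Y : choiceType) (L : simplicial_complex Y).
Variables (e : bool * V -> Y) (e' : Y -> bool * V).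
Hypotheses (eK : cancel e e') (e'K : cancel e' e).
Hypothesis LP : forall S : {fset Y}, simplex L S <->
  forall v w, e (true, v) \in S -> e (false, w) \in S -> ~~ G v w.

Notation N := (susp_complex (closed_nbhd_complex (compl_graph G))).
Notation north := (inl true : (bool + V)%type).
Notation south := (inl false : (bool + V)%type).
Notation half := (2^-1 : R).

Let side (b : bool) : pred Y := fun y => (e' y).1 == b.
Let equator : pred (bool + V) := fun z => if z is inr _ then true else false.

Let susp_pole (q : realization R N) : q north = 0 \/ q south = 0.
Proof.
have /(susp_closed_nbhd_complP _ v0)[+ _] := realization_simplex q.
by rewrite negb_and !mem_finsupp !negbK => /orP[] /eqP; [left|right].
Qed.

Let susp_apex (q : realization R N) b :
  (forall v, q (inr v) = 0) -> q (inl (~~ b)) = 0 -> q (inl b) = 1.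
Proof.
move=> qV qb; apply: realization_vertex => -[c|v] cb; last exact: qV.
by rewrite (_ : c = ~~ b)//; case: c b cb {qb} => -[].
Qed.

(** Without equatorial weight, the only pole that can carry weight would carry 1, more than
    [half]. *)
Let susp_equator (q : realization R N) :
  q north <= half -> q south <= half -> exists v, q (inr v) != 0.
Proof.
move=> qn qs; apply: contrapT => /forallNP qV.
have {}qV v : q (inr v) = 0.
  by apply/eqP; rewrite -[_ == _]negbK; apply/negP/qV.
have [q0|q0] := susp_pole q.
  by have := @susp_apex q false qV q0; lra.
by have := @susp_apex q true qV q0; lra.
Qed.

(** The choice depends on the finite set alone and not on [q], so only finitely many vertices are
    chosen over a closed simplex. Sets contained in no support receive the default [v0]. *)
Let common_nonnbr : exists c : {fset bool + V} -> V,
  forall (q : realization R N) S w, (S `<=` finsupp q)%fset -> inr w \in S ->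
    ~~ G (c S) w.
Proof.
have cP S : exists v, forall q : realization R N, (S `<=` finsupp q)%fset ->
    forall w, inr w \in S -> ~~ G v w.
  have [[q Sq]|nS] :=
    pselect (exists q : realization R N, (S `<=` finsupp q)%fset).
    have /(susp_closed_nbhd_complP _ v0)[_ [v vP]] := realization_simplex q.
    by exists v => _ _ w /(fsubsetP Sq); exact: vP.
  by exists v0 => q Sq; exfalso; apply: nS; exists q.
have [c cE] := choice cP; exists c => q S w Sq; exact: (cE S q Sq).
Qed.

Let massP b (p : realization R L) :
  0 < mass (side b) p <-> exists v, p (e (b, v)) != 0.
Proof.
split=> [/mass_gt0P[y /eqP yb py]|[v pv]].
  by exists (e' y).2; rewrite -yb -surjective_pairing e'K.
by apply: mass_gt0 pv; rewrite /side eK.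
Qed.

Let indep_simplexP (p : realization R L) v w :
  p (e (true, v)) != 0 -> p (e (false, w)) != 0 -> ~~ G v w.
Proof.
rewrite -!mem_finsupp; have /LP := realization_simplex p; exact.
Qed.

(** In the notation of the overview, [true] marks the copy of [V] carrying [a] and [false] the copy
    carrying [b]. *)
Let to_susp_weight (p : realization R L) (z : bool + V) : R :=
  match z with
  | inl true => Num.max 0 (mass (side false) p - mass (side true) p)
  | inl false => Num.max 0 (mass (side true) p - mass (side false) p)
  | inr v => mass (side false) p * p (e (true, v))
  end.

Let to_susp : exists f : realization R L -> realization R N,
  [/\ tame f,
      forall p, f p north != 0 -> exists w, p (e (false, w)) != 0,
      forall p, f p south != 0 -> exists v, p (e (true, v)) != 0 &
      forall p v, f p (inr v) != 0 ->
        p (e (true, v)) != 0 /\ exists w, p (e (false, w)) != 0].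
Proof.
have wV p v : to_susp_weight p (inr v) != 0 ->
    p (e (true, v)) != 0 /\ exists w, p (e (false, w)) != 0.
  rewrite /= mulf_eq0 negb_or => /andP[m0 ->]; split => //; apply/massP.
  by rewrite lt_def m0 mass_ge0.
have [||||s|f tf fE] := @tame_of_weights R Y (bool + V)%type L N to_susp_weight.
- move=> p [[]|v] /=; rewrite ?le_max ?lexx//.
  by rewrite mulr_ge0 ?mass_ge0 ?realization_ge0.
- move=> p; have [tf|ft|tf] := ltgtP (mass (side true) p) (mass (side false) p).
  + by exists north; rewrite /= max0_neq0 subr_gt0.
  + by exists south; rewrite /= max0_neq0 subr_gt0.
  (* Equal masses are both positive, because their common value cannot be 0; some equatorial weight
     is then nonzero. *)
  have [y py] := realization_neq0 p.
  have m0 : 0 < mass (side false) p.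
    have : 0 < mass (side (e' y).1) p by apply: mass_gt0 py; rewrite /side eqxx.
    by case: (e' y).1; rewrite ?tf.
  have : 0 < mass (side true) p by rewrite tf.
  by move=> /massP[v pv]; exists (inr v); rewrite /= mulf_neq0// gt_eqF.
- move=> p S Sw; apply/(susp_closed_nbhd_complP _ v0); split.
    apply/andP => -[/Sw + /Sw]; rewrite /= !max0_neq0 !subr_gt0.
    by move=> /lt_trans h /h; rewrite ltxx.
  (* Any vertex in the [false] support is a common non-neighbor of the equatorial vertices; if there
     is none, all equatorial weights vanish. *)
  have [[w pw]|nw] := pselect (exists w, p (e (false, w)) != 0).
    exists w => v /Sw /wV[pv _]; rewrite adj_sym; exact: indep_simplexP pw.
  by exists v0 => v /Sw /wV[_ /nw].
- move=> [[]|v] /=.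
  + apply: continuous_maxr; first exact: continuous_cst.
    by apply: continuous_sub; exact: continuous_mass.
  + apply: continuous_maxr; first exact: continuous_cst.
    by apply: continuous_sub; exact: continuous_mass.
  + apply: continuous_mul; first exact: continuous_mass.
    exact: continuous_coord.
- exists ([fset north; south] `|`
    [fset (inr (e' y).2 : bool + V) | y in s])%fset.
  move=> p /fsubsetP ps [b|v]; first by case: b; rewrite !inE eqxx ?orbT.
  move=> /wV[pv _]; rewrite !inE; apply/imfsetP; exists (e (true, v)).
    by apply: ps; rewrite mem_finsupp.
  by rewrite eK.
exists f; split => // [p|p|p v]; rewrite fE; last exact: wV.
  rewrite /= max0_neq0 subr_gt0 => h; apply/massP; apply: le_lt_trans h.
  exact: mass_ge0.
rewrite /= max0_neq0 subr_gt0 => h; apply/massP; apply: le_lt_trans h.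
exact: mass_ge0.
Qed.

(** The function [c] is the flag sum, of which only the absence of edges between its support and the
    top part is remembered. *)
Let of_susp : exists g : realization R N -> realization R L,
  exists c : realization R N -> V -> R,
  [/\ tame g,
      forall q v, g q (e (true, v)) != 0 ->
        q north < half /\ top_part equator q (inr v) != 0 \/ half < q south,
      forall q w, g q (e (false, w)) != 0 ->
        q south < half /\ c q w != 0 \/ half < q north &
      forall q v w, top_part equator q (inr v) != 0 -> c q w != 0 ->
        ~~ G v w].
Proof.
have [c cP] := common_nonnbr.
(* Once a pole coordinate reaches [half], one copy of [V] is emptied, and beyond [half] the vertex
   [v0] is switched on in the other without risk of an edge. The north pole goes to [(false, v0)],
   the south pole to [(true, v0)]. *)
pose wt (q : realization R N) v :=
  Num.max 0 (half - q north) * top_part equator q (inr v) +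
  Num.max 0 (q south - half) * (v == v0)%:R.
pose wf (q : realization R N) v :=
  Num.max 0 (half - q south) * flag_sum c equator q v +
  Num.max 0 (q north - half) * (v == v0)%:R.
pose w (q : realization R N) y :=
  if (e' y).1 then wt q (e' y).2 else wf q (e' y).2.
have sum_neq0 (a b a' b' : R) : Num.max 0 a * b + Num.max 0 a' * b' != 0 ->
    0 < a /\ b != 0 \/ 0 < a' /\ b' != 0.
  have [->|] := eqVneq (Num.max 0 a * b) 0; rewrite ?add0r mulf_eq0 negb_or.
    by rewrite max0_neq0 => /andP[]; right.
  by rewrite max0_neq0 => /andP[]; left.
have tP q v : w q (e (true, v)) != 0 ->
    q north < half /\ top_part equator q (inr v) != 0 \/ half < q south.
  rewrite /w eK /= => /sum_neq0; rewrite !subr_gt0.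
  by move=> [|[+ _]]; [left|right].
have fP q v : w q (e (false, v)) != 0 ->
    q south < half /\ flag_sum c equator q v != 0 \/ half < q north.
  rewrite /w eK /= => /sum_neq0; rewrite !subr_gt0.
  by move=> [|[+ _]]; [left|right].
have GP (q : realization R N) u v : top_part equator q (inr u) != 0 ->
    flag_sum c equator q v != 0 -> ~~ G u v.
  move=> qu /flag_sum_neq0[S [Sq <- Sw]]; rewrite adj_sym.
  by apply: (cP q S u Sq); exact: (flag_weight_top Sw _ qu).
have pos (a b a' b' : R) : 0 <= b -> 0 <= b' ->
    0 <= Num.max 0 a * b + Num.max 0 a' * b'.
  by move=> b0 b0'; rewrite addr_ge0// mulr_ge0// le_max lexx.
have [||||s|g tg gE] := @tame_of_weights R (bool + V)%type Y N L w.
- move=> q y; rewrite /w; case: ifP => _; apply: pos; rewrite ?ler0n//.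
    by rewrite le_max lexx.
  exact: flag_sum_ge0.
- move=> q; have [qn|qn] := ltP half (q north).
    exists (e (false, v0)); rewrite /w eK /= /wf eqxx mulr1.
    rewrite gt_eqF// ltr_wpDl ?mulr_ge0 ?flag_sum_ge0 ?le_max ?lexx//.
    by rewrite lt_max subr_gt0 qn orbT.
  have [qs|qs] := ltP half (q south).
    exists (e (true, v0)); rewrite /w eK /= /wt eqxx mulr1.
    rewrite gt_eqF// ltr_wpDl ?mulr_ge0 ?le_max ?lexx//.
    by rewrite lt_max subr_gt0 qs orbT.
  (* One pole coordinate vanishes, so the copy of [V] whose main term it damps gets the full
     coefficient [half]. *)
  have [v qv] := susp_equator qn qs; have [q0|q0] := susp_pole q.
    have [[//|u] _ qu] := @top_part_exists _ _ _ equator q (inr v) isT qv.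
    exists (e (true, u)); rewrite /w eK /= /wt gt_eqF//.
    rewrite ltr_pwDl ?mulr_ge0 ?le_max ?lexx ?ler0n//.
    rewrite mulr_gt0// ?lt_def ?qu ?le_max ?lexx//.
    by rewrite max0_neq0 q0 subr0 invr_gt0 ltr0n.
  have [u qu] := @flag_sum_exists _ _ _ _ c equator q (inr v) isT qv.
  exists (e (false, u)); rewrite /w eK /= /wf gt_eqF//.
  rewrite ltr_pwDl ?mulr_ge0 ?le_max ?lexx ?ler0n//.
  rewrite mulr_gt0// ?lt_def ?qu ?flag_sum_ge0 ?le_max ?lexx ?andbT//.
  by rewrite max0_neq0 q0 subr0 invr_gt0 ltr0n.
- move=> q S Sw; apply/LP => u v /Sw /tP qu /Sw /fP qv.
  (* Both copies can be occupied only when both pole coordinates are below [half]; there the top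
     part faces the flag sum. *)
  case: qu qv => [[qn qu]|qs] [[qs' qv]|qn']; last 3 first.
  + by move: qn; rewrite ltNge ltW.
  + by move: qs'; rewrite ltNge ltW.
  + by exfalso; have [] := susp_pole q; lra.
  exact: GP qu qv.
- move=> y; rewrite /w; case: (e' y).1.
    apply: continuous_add.
      apply: continuous_mul; last exact: continuous_top_part.
      apply: continuous_maxr; first exact: continuous_cst.
      by apply: continuous_sub; [exact: continuous_cst|exact: continuous_coord].
    apply: continuous_mul; last exact: continuous_cst.
    apply: continuous_maxr; first exact: continuous_cst.
    by apply: continuous_sub; [exact: continuous_coord|exact: continuous_cst].
  apply: continuous_add.
    apply: continuous_mul; last exact: continuous_flag_sum.
    apply: continuous_maxr; first exact: continuous_cst.
    by apply: continuous_sub; [exact: continuous_cst|exact: continuous_coord].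
  apply: continuous_mul; last exact: continuous_cst.
  apply: continuous_maxr; first exact: continuous_cst.
  by apply: continuous_sub; [exact: continuous_coord|exact: continuous_cst].
- pose u (z : bool + V) := if z is inr v then e (true, v) else e (true, v0).
  exists ([fset e (true, v0); e (false, v0)] `|` [fset u z | z in s] `|`
    [fset e (false, c t) | t in fpowerset s])%fset.
  move=> q /fsubsetP qs y; rewrite -(e'K y); case: (e' y) => -[] v.
    have [->|vv0] := eqVneq v v0; first by rewrite !inE eqxx.
    rewrite /w eK /= /wt (negPf vv0) mulr0 addr0 mulf_eq0 negb_or.
    move=> /andP[_ /top_part_neq0]; rewrite -mem_finsupp => /qs vs.
    rewrite !inE; apply/orP; left; apply/orP; right.
    by apply/imfsetP; exists (inr v).
  have [->|vv0] := eqVneq v v0; first by rewrite !inE eqxx orbT.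
  rewrite /w eK /= /wf (negPf vv0) mulr0 addr0 mulf_eq0 negb_or.
  move=> /andP[_ /flag_sum_neq0[t [tq <- _]]].
  rewrite !inE; apply/orP; right; apply/imfsetP; exists t => //=.
  by rewrite fpowersetE; apply/fsubsetP => z /(fsubsetP tq) /qs.
exists g, (flag_sum c equator); split => // [q v|q v]; rewrite gE.
  exact: tP.
exact: fP.
Qed.

Lemma susp_closed_nbhd_equivalent :
  homotopy_equivalent R (realization R N) (realization R L).
Proof.
have [f [tf fn fs fV]] := to_susp.
have [g [c [tg gt gf gG]]] := of_susp.
have half_gt0 : 0 < half by rewrite invr_gt0 ltr0n.
have poles (q : realization R N) : half < q north -> half < q south -> False.
  by have [] := susp_pole q; lra.
(* The intermediate stop: the coordinates that may conflict with [v0] vanish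
   before [v0] is switched on. *)
pose w1 (p : realization R L) y :=
  if (e' y).1 then Num.max 0 (half - f p north) *
    (top_part equator (f p) (inr (e' y).2) +
     Num.max 0 (f p south - half) * p y)
  else Num.max 0 (half - f p south) * p y.
have w1p p y : w1 p y != 0 -> p y != 0.
  rewrite /w1; case E : (e' y) => [[] v] /=;
    rewrite mulf_eq0 negb_or => /andP[_ //].
  have [p0|//] := eqVneq (p y) 0; rewrite p0 mulr0 addr0.
  by move=> /top_part_neq0 /fV[]; rewrite -E e'K p0 eqxx.
have w1t p v : w1 p (e (true, v)) != 0 ->
    f p north < half /\ top_part equator (f p) (inr v) != 0 \/
    half < f p south.
  rewrite /w1 eK /= mulf_eq0 negb_or max0_neq0 subr_gt0 => /andP[fn0].
  have [->|] := eqVneq (top_part equator (f p) (inr v)) 0; last by left.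
  by rewrite add0r mulf_eq0 negb_or max0_neq0 subr_gt0 => /andP[]; right.
have w1f p v : w1 p (e (false, v)) != 0 -> f p south < half.
  by rewrite /w1 eK /= mulf_eq0 negb_or max0_neq0 subr_gt0 => /andP[].
have cf y : continuous (fun p => f p y : R) by exact: tf.1.
have [||||s|h1 th1 h1E] := @tame_of_weights R Y Y L L w1.
- move=> p y; rewrite /w1; case: (e' y).1; rewrite mulr_ge0 ?le_max ?lexx//.
    by rewrite addr_ge0 ?mulr_ge0 ?realization_ge0 ?le_max ?lexx.
  exact: realization_ge0.
(* One pole coordinate of [f p] is 0. If it is the north one, the [true] copy survives, through its
   top part or, when the south one exceeds [half], through [p] itself; otherwise the [false] copy of
   [p] survives. *)
- move=> p; have [fn0|fn0] := eqVneq (f p north) 0.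
    have half0 : Num.max 0 (half - f p north) != 0.
      by rewrite max0_neq0 fn0 subr0.
    have [fs0|fs0] := ltP half (f p south).
      have [v pv] := fs p (lt0r_neq0 (lt_trans half_gt0 fs0)).
      exists (e (true, v)); rewrite /w1 eK /= mulf_neq0// gt_eqF//.
      rewrite ltr_wpDl ?mulr_gt0 ?realization_gt0 ?le_max ?lexx//.
      by rewrite lt_max subr_gt0 fs0 orbT.
    have fnh : f p north <= half by rewrite fn0 ltW.
    have [v pv] := susp_equator fnh fs0.
    have [[//|u] _ pu] := @top_part_exists _ _ _ equator _ (inr v) isT pv.
    exists (e (true, u)); rewrite /w1 eK /= mulf_neq0// gt_eqF//.
    rewrite ltr_pwDl ?mulr_ge0 ?realization_ge0 ?le_max ?lexx//.
    by rewrite lt_def pu le_max lexx.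
  have fs0 : f p south = 0.
    by have [/eqP|//] := susp_pole (f p); rewrite (negPf fn0).
  have [v pv] := fn p fn0; exists (e (false, v)).
  by rewrite /w1 eK /= mulf_neq0// max0_neq0 fs0 subr0.
- move=> p S Sw; apply: simplexS (realization_simplex p).
  by apply/fsubsetP => y /Sw /w1p; rewrite mem_finsupp.
- move=> y; rewrite /w1; case: (e' y).1; last first.
    apply: continuous_mul; last exact: continuous_coord.
    apply: continuous_maxr; first exact: continuous_cst.
    by apply: continuous_sub; [exact: continuous_cst|exact: cf].
  apply: continuous_mul.
    apply: continuous_maxr; first exact: continuous_cst.
    by apply: continuous_sub; [exact: continuous_cst|exact: cf].
  apply: continuous_add.
    move=> p; apply: (@continuous_comp _ _ _ f
      (fun q => top_part equator q (inr (e' y).2))).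
      exact: tame_continuous.
    exact: continuous_top_part.
  apply: continuous_mul; last exact: continuous_coord.
  apply: continuous_maxr; first exact: continuous_cst.
  by apply: continuous_sub; [exact: cf|exact: continuous_cst].
- by exists s => p ps y /w1p; rewrite -mem_finsupp; exact: (fsubsetP ps).
(* Intermediate stop on the suspension: a pole is kept only beyond [half], where the composite can
   no longer reach the opposite pole. *)
pose w2 (q : realization R N) z :=
  if z is inl b then Num.max 0 (q (inl b) - half) else q z.
have w2q q z : w2 q z != 0 -> q z != 0.
  case: z => [b|//]; rewrite /= max0_neq0 subr_gt0 => h.
  by rewrite gt_eqF// (lt_trans _ h)// invr_gt0 ltr0n.
have [||||s|h2 th2 h2E] := @tame_of_weights R _ _ N N w2.
- move=> q [b|v] /=; first by rewrite le_max lexx.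
  exact: realization_ge0.
- move=> q; have [[v qv]|nv] := pselect (exists v, q (inr v) != 0).
    by exists (inr v).
  have qV v : q (inr v) = 0.
    by apply/eqP; rewrite -[_ == _]negbK; apply/negP => qv; apply: nv; exists v.
  have [q0|q0] := susp_pole q.
    exists south; rewrite /= max0_neq0 (@susp_apex q false qV q0).
    by rewrite subr_gt0 invf_lt1 ?ltr1n.
  exists north; rewrite /= max0_neq0 (@susp_apex q true qV q0).
  by rewrite subr_gt0 invf_lt1 ?ltr1n.
- move=> q S Sw; apply: simplexS (realization_simplex q).
  by apply/fsubsetP => z /Sw /w2q; rewrite mem_finsupp.
- move=> [b|v] /=; last exact: continuous_coord.
  apply: continuous_maxr; first exact: continuous_cst.
  by apply: continuous_sub; [exact: continuous_coord|exact: continuous_cst].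
- by exists s => q qs z /w2q; rewrite -mem_finsupp; exact: (fsubsetP qs).
exists g, f; split; [exact: tame_continuous|exact: tame_continuous| |].
- apply: (homotopic_through (tame_comp tg tf) th2 (@tame_id _ _ N)) => q S Sq.
    apply/(susp_closed_nbhd_complP _ v0).
    have north_src : north \in S -> half < q north \/ f (g q) north != 0.
      by move=> /Sq[]; [right|rewrite h2E max0_neq0 subr_gt0; left].
    have south_src : south \in S -> half < q south \/ f (g q) south != 0.
      by move=> /Sq[]; [right|rewrite h2E max0_neq0 subr_gt0; left].
    split.
      apply/negP => /andP[/north_src nS /south_src sS].
      (* In the mixed cases, a pole of [q] beyond [half] has emptied the copy of [V] that the
         opposite pole of [f (g q)] requires. *)
      case: nS sS => [qn|qn] [qs|qs].
      + exact: poles qn qs.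
      + have [v /gt[[+ _]|]] := fs _ qs; last exact: poles.
        by rewrite ltNge ltW.
      + have [v /gf[[+ _]|]] := fn _ qn; last by move=> /poles; apply.
        by rewrite ltNge ltW.
      + by have [] := susp_pole (f (g q)) => q0; move: qn qs; rewrite q0 eqxx.
    (* An equatorial vertex of [f (g q)] requires both copies of [V] to be occupied, hence comes
       from the top part and lies in the support of [q]: a common non-neighbor for [q] suffices. *)
    have /(susp_closed_nbhd_complP _ v0)[_ [v vq]] := realization_simplex q.
    exists v => w wS; apply: vq; rewrite mem_finsupp.
    have [/fV[gw [u gu]]|] := Sq _ wS; last by rewrite h2E.
    case: (gt _ _ gw) => [[_ /top_part_neq0 //]|qs].
    case: (gf _ _ gu) => [[+ _]|qn]; first by rewrite ltNge ltW.
    by exfalso; exact: poles qn qs.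
  apply: simplexS (realization_simplex q); apply/fsubsetP => z /Sq.
  by rewrite mem_finsupp h2E => -[/w2q|].
- apply: (homotopic_through (tame_comp tf tg) th1 (@tame_id _ _ L)) => p S Sp.
    apply/LP => v w /Sp vS /Sp wS.
    have {}vS : f p north < half /\ top_part equator (f p) (inr v) != 0 \/
        half < f p south.
      by case: vS => [/gt//|]; rewrite h1E => /w1t.
    have {}wS : f p south < half /\ (p (e (false, w)) != 0 \/ c (f p) w != 0)
        \/ half < f p north.
      case: wS => [/gf[[fs0 cw]|]|]; [by left; split=> //; right|by right|].
      by rewrite h1E => w1w; left; split; [exact: w1f w1w|left; exact: w1p].
    case: vS wS => [[fn0 vS]|fs0] [[fs1 wS]|fn1]; last 3 first.
    + by move: fn0; rewrite ltNge ltW.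
    + by move: fs1; rewrite ltNge ltW.
    + by exfalso; exact: poles fn1 fs0.
    (* Vertices of the top part of [f p] already lie in the [true] support of [p], so they have no
       edge to the [false] support of [p]. *)
    case: wS => [pw|cw]; last exact: gG vS cw.
    by have [pv _] := fV _ _ (top_part_neq0 vS); exact: indep_simplexP pw.
  apply: simplexS (realization_simplex p); apply/fsubsetP => y /Sp.
  by rewrite mem_finsupp h1E => -[/w1p|].
Qed.
End SuspensionEquivalence.

(** * The two target complexes *)

Lemma indep_prod_K2P (V : choiceType) (G : graph V) (S : {fset bool * V}) :
  simplex (indep_complex (prod_graph K2 G)) S <->
  forall v w, (true, v) \in S -> (false, w) \in S -> ~~ G v w.
Proof.
split=> [SI v w vS wS|SI [a v] [b w] vS wS]; first exact: (SI _ _ vS wS).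
rewrite /= /prod_adj /=; case: a b vS wS => -[] // vS wS; first exact: SI.
by rewrite adj_sym; exact: SI.
Qed.

(** Adjacent vertices have opposite colors, so for adjacent [v] and [w] the relabelling [e] sends
    [(true, v)] and [(false, w)] to the same factor of the join, and every edge inside a factor
    arises in this way. *)
Lemma join_indepP (V : choiceType) (G : graph V) (c : V -> bool)
    (cG : forall v w, G v w -> c v != c w) (S : {fset V + V}) :
  let e x := if x.1 == c x.2 then inl x.2 else inr x.2 in
  simplex (join_complex (indep_complex G) (indep_complex G)) S <->
  forall v w, e (true, v) \in S -> e (false, w) \in S -> ~~ G v w.
Proof.
move=> e; have [s sS] := fset_inl_preimage S.
have [t tS] := fset_inr_preimage S.
rewrite (join_simplexP _ _ sS tS); split=> [[sI tI] v w|SI].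
  rewrite /e /=; case cv : (c v); case cw : (c w) => /=.
  - by move=> _ _; apply/negP => /cG; rewrite cv cw.
  - by rewrite -!sS; exact: sI.
  - by rewrite -!tS; exact: tI.
  - by move=> _ _; apply/negP => /cG; rewrite cv cw.
split=> v w; rewrite ?sS ?tS => vS wS; apply/negP => vw;
  have := cG _ _ vw; case cv : (c v); case cw : (c w) => // _.
- by move: vw; apply/negP/SI; rewrite /e /= ?cv ?cw.
- by move: vw; rewrite adj_sym; apply/negP/SI; rewrite /e /= ?cv ?cw.
- by move: vw; rewrite adj_sym; apply/negP/SI; rewrite /e /= ?cv ?cw.
- by move: vw; apply/negP/SI; rewrite /e /= ?cv ?cw.
Qed.

Theorem theorem1p2 (R : realType) (V : choiceType) (G : graph V)
    (V_neq0 : [set: V] !=set0) :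
  homotopy_equivalent R
    (realization R (susp_complex (closed_nbhd_complex (compl_graph G))))
    (realization R (indep_complex (prod_graph K2 G))) /\
  (bipartite G ->
   homotopy_equivalent R
     (realization R (susp_complex (closed_nbhd_complex (compl_graph G))))
     (realization R (join_complex (indep_complex G) (indep_complex G)))).
Proof.
have [v0 _] := V_neq0; split.
  exact: (@susp_closed_nbhd_equivalent R V G v0 _ _ id id _ _
    (@indep_prod_K2P V G)).
move=> [c cG].
(* Inverse relabelling: the color recovers the copy. The last branch is a default that is never
   reached. *)
pose e' (z : V + V) := if z is inl v then (c v, v) else
  if z is inr v then (~~ c v, v) else (true, v0).
apply: (@susp_closed_nbhd_equivalent R V G v0 _ _ _ e' _ _ (join_indepP cG)).
  by move=> [a v]; rewrite /e' /=; case: a; case cv: (c v); rewrite /= ?cv.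
by move=> [v|v] /=; rewrite ?eqxx//; case: (c v).
Qed.
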